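(* Let $n\ge 2$, $m\ge1$ and $1\le r<n$ be integers. Then $$\mathcal{B}(n,r,m)\le\bar{\mathcal{B}}(n,r,m)\le\frac{(n-r+1)(n-r)}{2}+1.$$ Moreover, if $m\le n-r$, then $$n-r+1+\frac{m(m-1)}{2}\le\mathcal{B}(n,r,m)\le\bar{\mathcal{B}}(n,r,m).$$ Consequently, if $m\ge n-r$, then $\mathcal{B}(n,r,m)=\bar{\mathcal{B}}(n,r,m)=\frac{(n-r+1)(n-r)}{2}+1$.
   Context: Consider switched linear control systems $x_k=A_{i_k}x_{k-1}+B_{i_k}u_k$, $k\ge1$, on $\mathbb{R}^n$ with $m$ modes $(A_i,B_i)$, $i\in\Sigma=\{1,\dots,m\}$, $A_i$ real $n\times n$ and $B_i$ real with $n$ rows. For a word $\pi=i_1\cdots i_k$ over $\Sigma$, $\mathcal{R}(\pi)=\mathrm{Im}(A_{i_k}\cdots A_{i_2}B_{i_1},\dots,A_{i_k}B_{i_{k-1}},B_{i_k})$ is the set of states reachable at time $k$ from $x_0=0$ with switching sequence $i_1,\dots,i_k$; $\pi$ is a controllable sequence if $\mathcal{R}(\pi)=\mathbb{R}^n$, and the system is controllable if the union of all $\mathcal{R}(\pi)$ is $\mathbb{R}^n$. $\mathcal{B}(n,r,m)$ denotes the maximum, over all controllable such systems on $\mathbb{R}^n$ with $m$ modes in which every $A_i$ is invertible and every $B_i$ has rank exactly $r$, of the minimal length of a controllable sequence. $\bar{\mathcal{B}}(n,r,m)$ is defined in the same way but maximizing over systems in which every $A_i$ is invertible and every $B_i$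 has rank at least $r$. *)

(* Defs.v *)
From HB Require Import structures.
From mathcomp Require Import all_boot all_order all_algebra.
From mathcomp Require Import Rstruct.
From Stdlib Require Rdefinitions.

Set Implicit Arguments.
Unset Strict Implicit.
Unset Printing Implicit Defensive.

Import GRing.Theory.
Local Open Scope ring_scope.

Record switched_system (n m : nat) := SwSys {
  sysA : 'I_m -> 'M[Rdefinitions.R]_n;
  sysp : 'I_m -> nat;
  sysB : forall i : 'I_m, 'M[Rdefinitions.R]_(n, sysp i)
}.

Section Reach.
Variables (n m : nat) (S : switched_system n m).

(* For a word s = i_1 ... i_k (s`_j = i_(j+1)), the transpose of the block
   A_(i_k) ... A_(i_(j+2)) B_(i_(j+1)), i.e. (B_(i_(j+1)))^T A_(i_(j+2))^T ... A_(i_k)^T. *)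
Definition reach_block (s : seq 'I_m) (i : 'I_m) (j : nat) : 'M[Rdefinitions.R]_(sysp S i, n) :=
  foldl (fun M a => M *m (sysA S a)^T) (sysB S i)^T (drop j.+1 s).

(* Row space (in transposed form) of R(s) = Im(A_(i_k)..A_(i_2)B_(i_1), ..., B_(i_k)):
   the sum of the column spaces of the blocks. *)
Definition reach (s : seq 'I_m) : 'M[Rdefinitions.R]_n :=
  (\sum_(j < size s) << reach_block s (tnth (in_tuple s) j) j >>)%MS.

Definition reachable_in (s : seq 'I_m) (x : 'rV[Rdefinitions.R]_n) : Prop := (x <= reach s)%MS.

Definition controllable_seq (s : seq 'I_m) : Prop :=
  forall x : 'rV[Rdefinitions.R]_n, reachable_in s x.

Definition controllable : Prop :=
  forall x : 'rV[Rdefinitions.R]_n, exists s : seq 'I_m, reachable_in s x.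

Definition min_ctrl_length (k : nat) : Prop :=
  (exists s, size s = k /\ controllable_seq s) /\
  (forall s, controllable_seq s -> (k <= size s)%N).

End Reach.

Definition classB (n r m : nat) (S : switched_system n m) : Prop :=
  controllable S /\ (forall i, sysA S i \in unitmx) /\ (forall i, \rank (sysB S i) = r).

Definition classBbar (n r m : nat) (S : switched_system n m) : Prop :=
  controllable S /\ (forall i, sysA S i \in unitmx) /\ (forall i, (r <= \rank (sysB S i))%N).

Definition is_max_min_length (n m : nat) (C : switched_system n m -> Prop) (b : nat) : Prop :=
  (exists S, C S /\ min_ctrl_length S b) /\
  (forall S k, C S -> min_ctrl_length S k -> (k <= b)%N).

Definition is_B (n r m b : nat) : Prop := is_max_min_length (@classB n r m) b.
Definition is_Bbar (n r m b : nat) : Prop := is_max_min_length (@classBbar n r m) b.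

(* Main.v *)
(** Row vectors are used, so a letter i acts on a subspace V by V a_i + b_i.
    Upper bound.  Let W_k be the sum of the spaces that words of length at most k
    can steer to 0; if W_(k+1) = W_k then W_k is everything, so W_k gains a
    dimension at each step.  If no word of length k enlarges a reachable space V
    then W_k is contained in V.  Hence a space of dimension d >= r can be enlarged
    within d - r + 1 letters, unless V = W_(d-r+1) and every rank is minimal; in
    that case replacing the last letter of the word reaching V produces another
    space of dimension d, which can be enlarged.
    Lower bound.  The A_i are permutation matrices, and a word fills the r source
    coordinates and then permutes.  On the coordinates at distance 0, ..., n - r
    from the sources, M modes are adjacent transpositions near the sources and the
    others cycle the remaining far coordinates.  A potential of the set of empty
    coordinates drops by at most one per letter. *)
Require Import Defs.
From mathcomp Require Import all_boot all_order all_algebra.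
From mathcomp Require Import perm zify.
From mathcomp Require Import Rstruct.
From Stdlib Require Import Classical_Prop.
From Stdlib Require Rdefinitions.

Set Implicit Arguments.
Unset Strict Implicit.
Unset Printing Implicit Defensive.

Import GRing.Theory.
Local Open Scope ring_scope.

(** * Upper bound: enlarging a reachable space by short words *)

Section Extension.
Variables (F : fieldType) (n m : nat) (p : 'I_m -> nat).
Variables (a : 'I_m -> 'M[F]_n) (b : forall i, 'M[F]_(p i, n)).
Hypothesis a_unit : forall i, a i \in unitmx.

Definition ext (V : 'M[F]_n) (s : seq 'I_m) : 'M[F]_n :=
  foldl (fun V i => (V *m a i + b i)%MS) V s.

(* W_k: the sum over words s of length at most k of (space reached by s) a_s^-1. *)
Fixpoint pull (k : nat) : 'M[F]_n :=
  if k is k'.+1 then (\sum_i ((pull k' + b i)%MS *m invmx (a i)))%MS else 0.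

(* Equivalent to controllability when all [a i] are invertible; unlike it, this
   is a condition on a single subspace. *)
Definition only_full_invariant :=
  forall V : 'M[F]_n, (forall i, ((V + b i)%MS *m invmx (a i) <= V)%MS) -> row_full V.

Lemma mulmx_sub_inv q1 q2 (V : 'M_(q1, n)) (U : 'M_(q2, n)) i :
  (V *m invmx (a i) <= U)%MS = (V <= U *m a i)%MS.
Proof.
apply/idP/idP => [/(submxMr (a i))|/(submxMr (invmx (a i)))].
  by rewrite mulmxKV.
by rewrite mulmxK.
Qed.

Lemma mxrank_mul_unit q (V : 'M_(q, n)) i : \rank (V *m a i) = \rank V.
Proof. by rewrite mxrankMfree // row_free_unit. Qed.

Lemma mxrank_mul_inv q (V : 'M_(q, n)) i : \rank (V *m invmx (a i)) = \rank V.
Proof. by rewrite mxrankMfree // row_free_unit unitmx_inv. Qed.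

Lemma pullS_sub k q (U : 'M_(q, n)) :
  reflect (forall i, (pull k <= U *m a i)%MS /\ (b i <= U *m a i)%MS)
          (pull k.+1 <= U)%MS.
Proof.
apply: (iffP sumsmx_subP) => h i => [|_].
  by have := h i isT; rewrite mulmx_sub_inv addsmx_sub => /andP[].
by rewrite mulmx_sub_inv addsmx_sub; have [-> ->] := h i.
Qed.

Lemma pull_mono k : (pull k <= pull k.+1)%MS.
Proof.
elim: k => [|k IHk]; first exact: sub0mx.
apply/pullS_sub => i; have [/(submx_trans IHk)] := elimT (pullS_sub _ _) (submx_refl (pull k.+2)) i.
by [].
Qed.

Lemma pull1_sub k : (pull 1 <= pull k.+1)%MS.
Proof.
by elim: k => // k IHk; apply: submx_trans IHk (pull_mono _).
Qed.

(** A letter that does not raise the rank gives [V *m a i + b i] the same span as [V *m a i], which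
    therefore contains [b i]. That space is again stuck, for words one letter shorter, so by
    induction it contains [pull k]. *)
Lemma pull_sub_of_stuck k V :
  (forall s, (size s <= k)%N -> (\rank (ext V s) <= \rank V)%N) -> (pull k <= V)%MS.
Proof.
elim: k V => [|k IHk] V stuck; first exact: sub0mx.
apply/pullS_sub => i; set V1 := (V *m a i + b i)%MS.
have rV1 : (\rank V1 <= \rank (V *m a i)%R)%N by rewrite mxrank_mul_unit (stuck [:: i]).
have V1sub : (V1 <= V *m a i)%MS by rewrite -(geq_leqif (mxrank_leqif_sup (addsmxSl _ _))).
split; last exact: submx_trans (addsmxSr _ _) V1sub.
apply: submx_trans V1sub; apply: IHk => s s_le.
apply: leq_trans (stuck (i :: s) s_le) _.
by rewrite -(mxrank_mul_unit V i) mxrankS ?addsmxSl.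
Qed.

Hypothesis full_inv : only_full_invariant.

Lemma pull_stationary_full k : (pull k.+1 <= pull k)%MS -> row_full (pull k).
Proof.
move=> /pullS_sub st; apply: full_inv => i.
by rewrite mulmx_sub_inv addsmx_sub; have [-> ->] := st i.
Qed.

Lemma pull_rank_growth k : ~~ row_full (pull k.+1) -> (\rank (pull 1) + k <= \rank (pull k.+1))%N.
Proof.
elim: k => [|k IHk] nf; first by rewrite addn0.
have nf' : ~~ row_full (pull k.+1).
  by apply: contra nf => /(submx_full _) f; rewrite -sub1mx; apply: submx_trans (f _ _) (pull_mono _).
rewrite addnS; apply: leq_ltn_trans (IHk nf') _.
rewrite ltn_neqAle mxrankS ?pull_mono // andbT; apply: contra nf' => /eqP e.
apply: pull_stationary_full; rewrite -(geq_leqif (mxrank_leqif_sup (pull_mono _))).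
by rewrite e.
Qed.

Variable r : nat.
Hypothesis b_rank : forall i, (r <= \rank (b i))%N.

(* Changing the letter that produced the current space is essential: that space
   may be exactly [pull k], which no word of length [k] enlarges. *)
Lemma ext_grow V0 i (d : nat) :
  \rank (ext V0 [:: i]) = d -> (r <= d < n)%N ->
  exists j s, (size s <= d - r + 1)%N /\ (d < \rank (ext V0 (j :: s)))%N.
Proof.
move=> rV /andP[rd dn]; set k := (d - r)%N; rewrite addn1.
(* Words of bounded length form a finite type, so this case split is on a boolean. *)
have [/existsP[j /existsP[q /existsP[s /andP[? ?]]]]|] :=
  boolP [exists j : 'I_m, exists q : 'I_k.+2, exists s : q.-tuple 'I_m,
    (size s <= k.+1)%N && (d < \rank (ext V0 (j :: s)))%N].
  by exists j, s.
move=> nex; exfalso.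
have stuck j s : (size s <= k.+1)%N -> (\rank (ext V0 (j :: s)) <= d)%N.
  move=> ss; rewrite leqNgt; apply: contra nex => gt.
  apply/existsP; exists j; apply/existsP; exists (Ordinal (ss : (size s < k.+2)%N)).
  by apply/existsP; exists (in_tuple s); rewrite ss.
have stuckV j : \rank (ext V0 [:: j]) = d -> (pull k.+1 <= ext V0 [:: j])%MS.
  by move=> rj; apply: pull_sub_of_stuck => s ss; rewrite rj; apply: (stuck j).
have notfull : ~~ row_full (pull k.+1).
  rewrite /row_full; have := mxrankS (stuckV i rV); rewrite rV; lia.
have grow := pull_rank_growth notfull.
have base j : (b j *m invmx (a j) <= pull 1)%MS.
  rewrite mulmx_sub_inv; have := elimT (pullS_sub 0 (pull 1)) (submx_refl _) j.
  by case.
(* [pull k.+1] has rank at least [\rank (pull 1) + k] and lies in a space of rank [d = r + k]. *)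
have rk1 : (\rank (pull 1) <= r)%N.
  have := mxrankS (stuckV i rV); rewrite rV; rewrite /k in grow *; lia.
have pull1E j : (pull 1 <= b j *m invmx (a j))%MS.
  rewrite -(geq_leqif (mxrank_leqif_sup (base j))) mxrank_mul_inv.
  exact: leq_trans rk1 (b_rank j).
(* All [b j *m invmx (a j)] span [pull 1], so replacing the last letter by [j] only changes which
   [a j] acts on [U]. Each resulting space thus has rank [d] and contains [pull k.+1]. *)
pose U := (V0 + pull 1)%MS.
have extE j : (ext V0 [:: j] :=: U *m a j)%MS.
  apply: eqmx_trans (eqmx_sym (addsmxMr _ _ _)); apply: adds_eqmx => //.
  apply/eqmxP/andP; split; first by rewrite -mulmx_sub_inv base.
  by have := submxMr (a j) (pull1E j); rewrite mulmxKV.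
have rU : \rank U = d by rewrite -rV extE mxrank_mul_unit.
have rkE : (d <= \rank (pull k.+1))%N.
  apply: leq_trans grow; rewrite -(subnKC rd) leq_add2r.
  by apply: leq_trans (mxrankS (base i)); rewrite mxrank_mul_inv.
have pullU j : (pull k.+1 <= U *m a j)%MS.
  by have := stuckV j; rewrite !extE mxrank_mul_unit rU; apply.
have subU : (pull k.+1 <= U)%MS.
  apply/pullS_sub => j; split; first exact: submx_trans (pull_mono k) (pullU j).
  by rewrite -mulmx_sub_inv (submx_trans (base j)) ?addsmxSr.
(* By dimension [U] is [pull k.+1], hence [pull k.+1 <= pull k.+1 *m a j] for every [j], which makes
   [pull] stationary at [k.+1]. *)
have Usub : (U <= pull k.+1)%MS by rewrite -(geq_leqif (mxrank_leqif_sup subU)) rU.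
case/negP: notfull; apply: pull_stationary_full; apply/pullS_sub => j; split.
  by apply: submx_trans (pullU j) _; apply: submxMr.
by rewrite -mulmx_sub_inv (submx_trans (base j)) ?pull1_sub.
Qed.

(** Passing from rank [r + e] to [r + e + 1] replaces the last letter and appends at most [e + 1]
    others; these costs add up to a binomial coefficient, plus one for the first letter. *)
Lemma exists_ext_full (i0 : 'I_m) : (0 < r <= n)%N ->
  exists s, (size s <= ((n - r + 1) * (n - r))./2 + 1)%N /\ row_full (ext 0 s).
Proof.
move=> /andP[r0 rn].
suff /(_ (n - r)%N (leqnn _)) [s [ss rs]] : forall e, (e <= n - r)%N ->
    exists s, (size s <= 'C(e.+1, 2) + 1)%N /\ (r + e <= \rank (ext 0 s))%N.
  exists s; split; first by move: ss; rewrite bin2 (addn1 (n - r)).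
  by rewrite /row_full eqn_leq rank_leq_row /= -{1}(subnKC rn).
elim=> [|e IHe] le.
  exists [:: i0]; split=> //; rewrite addn0 /=.
  exact: leq_trans (b_rank i0) (mxrankS (addsmxSr _ _)).
have [s [ss]] := IHe (ltnW le); rewrite leq_eqVlt => /orP[/eqP rs|rs]; last first.
  exists s; split; last by rewrite addnS.
  by apply: leq_trans ss _; rewrite leq_add2r binS leq_addr.
case/lastP: s ss rs => [|s i] ss rs.
  by move: rs; rewrite /= mxrank0; lia.
rewrite /ext -cats1 foldl_cat -!/(ext _ _) in rs.
have [|j [t [st rt]]] := ext_grow (esym rs); first by lia.
exists (s ++ j :: t); split; last by rewrite /ext foldl_cat addnS.
move: ss; rewrite size_rcons size_cat /= [in X in _ -> X]binS bin1; lia.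
Qed.

End Extension.

(** * Translation between switched systems and subspace recursions *)

Section Reach.
Variables (n m : nat) (S : switched_system n m).
Hypothesis A_unit : forall i, sysA S i \in unitmx.

Local Notation a := (fun i => (sysA S i)^T).
Local Notation b := (fun i => (sysB S i)^T).
Local Notation extS := (@ext _ n m (sysp S) a b).

Lemma tr_unit i : a i \in unitmx.
Proof. by rewrite unitmx_tr. Qed.

Lemma reach_nth i0 s :
  reach S s = (\sum_(j < size s) << reach_block S s (nth i0 s j) j >>)%MS.
Proof. by apply: eq_bigr => j _; rewrite (tnth_nth i0). Qed.

Lemma reach_rcons s i : (reach S (rcons s i) :=: reach S s *m a i + b i)%MS.
Proof.
rewrite !(reach_nth i) size_rcons big_ord_recr /=; apply: adds_eqmx.
  apply: eqmx_trans _ (eqmx_sym (sumsmxMr _ _ _)); apply: eqmx_sums => j _.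
  apply: eqmx_trans (genmxE _) _.
  rewrite nth_rcons ltn_ord /reach_block drop_rcons // foldl_rcons.
  exact/eqmx_sym/eqmxMr/genmxE.
apply: eqmx_trans (genmxE _) _.
by rewrite nth_rcons ltnn eqxx /reach_block drop_oversize ?size_rcons.
Qed.

Lemma reachE s : (reach S s :=: extS 0 s)%MS.
Proof.
elim/last_ind: s => [|s i IHs]; first by rewrite /reach big_ord0.
apply: eqmx_trans (reach_rcons s i) _; rewrite /ext foldl_rcons.
by apply: adds_eqmx => //; apply: eqmxMr.
Qed.

Lemma controllable_seqP s : controllable_seq S s <-> row_full (extS 0 s).
Proof.
rewrite -sub1mx -(reachE s); split=> [h|h x]; first by apply/row_subP => j; apply: h.
by apply: submx_trans h; rewrite submx1.
Qed.

(** Invertibility turns [V <= V *m a i] into an equality of spans, so [V] absorbs every reachable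
    space, and in particular every basis vector. *)
Lemma controllable_only_full : controllable S -> only_full_invariant a b.
Proof.
move=> ctrl V invV; rewrite -sub1mx; apply/row_subP => x.
have [s] := ctrl (row x 1%:M); rewrite /reachable_in reachE => /submx_trans; apply.
have inv i : (V <= V *m a i)%MS /\ (b i <= V *m a i)%MS.
  have := invV i; rewrite (mulmx_sub_inv tr_unit) addsmx_sub.
  by case/andP.
elim/last_ind: s => [|s i IHs]; first exact: sub0mx.
have VA : (V *m a i <= V)%MS.
  by rewrite -(geq_leqif (mxrank_leqif_sup (inv i).1)) (mxrank_mul_unit tr_unit).
rewrite /ext foldl_rcons addsmx_sub !(submx_trans _ VA) ?(inv i).2 //.
exact: submxMr.
Qed.

Lemma only_full_controllable r : only_full_invariant a b ->
  (forall i, (r <= \rank (sysB S i))%N) -> (0 < r <= n)%N -> (0 < m)%N ->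
  exists s, (size s <= ((n - r + 1) * (n - r))./2 + 1)%N /\ controllable_seq S s.
Proof.
move=> full rkB rn m0.
have [i|s [ss fs]] := exists_ext_full tr_unit full (r := r) _ (Ordinal m0) rn.
  by rewrite mxrank_tr.
by exists s; split=> //; apply/controllable_seqP.
Qed.

Lemma min_ctrl_length_exists s : controllable_seq S s ->
  exists2 k, min_ctrl_length S k & (k <= size s)%N.
Proof.
move=> /controllable_seqP fs.
pose Q k := [exists t : k.-tuple 'I_m, row_full (extS 0 t)].
have Qs t : row_full (extS 0 t) -> Q (size t).
  by move=> ft; apply/existsP; exists (in_tuple t).
have exQ : exists k, Q k by exists (size s); apply: Qs.
case: (ex_minnP exQ) => k /existsP[t ft] kmin; exists k; last exact/kmin/Qs.
split; first by exists t; rewrite size_tuple; split=> //; apply/controllable_seqP.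
by move=> u /controllable_seqP fu; apply/kmin/Qs.
Qed.

End Reach.

(** * Lower bound: a system of permutations that fills slowly *)

Section SlowSystem.
Variables n r m M : nat.
Hypotheses (r_gt0 : (0 < r)%N) (Mm : (M < m)%N) (Mn : (r + M < n)%N).

(* Modes i < M swap the coordinates at distance i and i+1 from the sources, the
   coordinate r-1 counting as distance 0; all other modes cycle the coordinates
   from distance M on, moving each of them one step closer. *)
Definition slow_move (i x : nat) : nat :=
  if (i < M)%N then
    if x == (r + i).-1 then (r + i)%N else if x == (r + i)%N then (r + i).-1 else x
  else if (x < (r + M).-1)%N then x else if x == (r + M).-1 then n.-1 else x.-1.

Lemma slow_move_lt i x : (x < n)%N -> (slow_move i x < n)%N.
Proof. rewrite /slow_move; repeat case: ifP; lia. Qed.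

Lemma slow_move_inj i (x y : 'I_n) : slow_move i x = slow_move i y -> x = y.
Proof.
have := ltn_ord x; have := ltn_ord y => yn xn e; apply: val_inj; move: e => /=.
rewrite /slow_move; repeat case: ifP; lia.
Qed.

Definition slow_fun i (x : 'I_n) : 'I_n := Ordinal (slow_move_lt i (ltn_ord x)).

Lemma slow_fun_inj i : injective (slow_fun i).
Proof. by move=> x y [] /slow_move_inj. Qed.

Definition slow_perm i : {perm 'I_n} := perm (@slow_fun_inj i).

Lemma slow_permE i x : slow_perm i x = slow_move i x :> nat.
Proof. by rewrite permE. Qed.

(** The factor [perm_mx] in the input matrix makes a letter act as [(V + pid_mx r) *m a i]: sources
    are filled first, then everything moves. *)
Definition slow_system : switched_system n m :=
  @SwSys n m (fun i => (perm_mx (slow_perm i))^T) (fun=> r)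
    (fun i => (perm_mx (slow_perm i))^T *m pid_mx r).

Local Notation a := (fun i => (sysA slow_system i)^T).
Local Notation b := (fun i => (sysB slow_system i)^T).

Lemma slow_aE i : a i = perm_mx (slow_perm i).
Proof. exact: trmxK. Qed.

Lemma slow_bE i : b i = pid_mx r *m perm_mx (slow_perm i).
Proof. by rewrite /= trmx_mul trmxK tr_pid_mx. Qed.

Lemma slow_A_unit i : sysA slow_system i \in unitmx.
Proof. by rewrite unitmx_tr unitmx_perm. Qed.

Lemma slow_B_rank i : \rank (sysB slow_system i) = r.
Proof.
rewrite -mxrank_tr slow_bE mxrankMfree ?row_free_unit ?unitmx_perm //.
by rewrite rank_pid_mx //; lia.
Qed.

(* The span of the sources pulls back, one coordinate at a time, to everything. *)
Lemma slow_only_full : only_full_invariant a b.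
Proof.
move=> V invV; rewrite -sub1mx; apply/row_subP => x; rewrite row1.
have inv i : (V *m invmx (a i) <= V)%MS /\ (b i *m invmx (a i) <= V)%MS.
  have := invV i; rewrite !(mulmx_sub_inv (tr_unit slow_A_unit)) addsmx_sub.
  by case/andP.
elim/ltn_ind: (x : nat) {-2}x (erefl (x : nat)) => k IHk {}x xk.
have [xr|rx] := ltnP x r.
  have [_] := inv (Ordinal Mm); apply: submx_trans.
  rewrite slow_bE slow_aE mulmxK ?unitmx_perm //.
  have -> : delta_mx 0 x = delta_mx (0 : 'I_1) (Ordinal xr) *m pid_mx r :> 'rV[Rdefinitions.R]_n.
    by rewrite -rowE; apply/rowP => y; rewrite !mxE /= xr andbT eq_sym.
  exact: submxMl.
(* This mode moves [x] one step closer: the swap numbered [x - r] if [x] is near, the cycle [M]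
   otherwise. *)
have jm : ((if x < r + M then x - r else M) < m)%N by case: ifP; lia.
pose j := Ordinal jm; pose y := slow_perm j x.
have yx : y = x.-1 :> nat.
  rewrite slow_permE /slow_move /=; repeat case: ifP; lia.
have Vy : (delta_mx (0 : 'I_1) y <= V)%MS by apply: (IHk y) => //; lia.
have -> : delta_mx (0 : 'I_1) x = delta_mx (0 : 'I_1) y *m invmx (a j) :> 'rV_n.
  have {1}-> : delta_mx 0 y = delta_mx (0 : 'I_1) x *m a j :> 'rV[Rdefinitions.R]_n.
    by rewrite slow_aE -rowE; apply/rowP => z; rewrite !mxE /= eq_sym.
  by rewrite mulmxK // tr_unit //; apply: slow_A_unit.
by apply: submx_trans (inv j).1; apply: submxMr.
Qed.

Definition sources : {set 'I_n} := [set x : 'I_n | (x < r)%N].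

Definition holes (s : seq 'I_m) : {set 'I_n} :=
  foldl (fun H (i : 'I_m) => slow_perm i @: (H :\: sources)) setT s.

Lemma holes_rcons s i : holes (rcons s i) = slow_perm i @: (holes s :\: sources).
Proof. by rewrite /holes foldl_rcons. Qed.

Lemma ext_holes s x : x \in holes s -> ext a b 0 s *m delta_mx x (0 : 'I_1) = 0.
Proof.
elim/last_ind: s x => [|s i IHs] x; first by rewrite mul0mx.
rewrite holes_rcons => /imsetP[y /setDP[yH yS] ->{x}].
have shift : perm_mx (slow_perm i) *m delta_mx (slow_perm i y) 0 = delta_mx y 0 :> 'cV[Rdefinitions.R]_n.
  rewrite -row_permE; apply/colP => z; rewrite !mxE.
  by rewrite (inj_eq perm_inj).
apply/eqP; rewrite /ext foldl_rcons -sub_kermx addsmx_sub !sub_kermx.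
rewrite slow_bE slow_aE -!mulmxA shift IHs // eqxx /= -colE; apply/eqP/colP => z.
by rewrite !mxE; move: yS; rewrite inE -leqNgt; case: eqP => //= ->; rewrite ltnNge => ->.
Qed.

Lemma holes_controllable s : controllable_seq slow_system s -> holes s = set0.
Proof.
move=> /controllable_seqP full; apply/eqP; apply: contraT => /set0Pn[x /ext_holes e].
have := row_full_inj full (etrans e (esym (mulmx0 _ _))).
by move/matrixP/(_ x 0)/eqP; rewrite !mxE !eqxx oner_eq0.
Qed.

(* A swap moves at most one hole closer, whereas a cycle moves all the far holes
   together: near distances are therefore summed and far ones maximised. *)
Definition weight (x : nat) : nat := minn (x - r.-1) M.
Definition excess (x : nat) : nat := (x - r.-1 - M)%N.

Definition potential (H : {set 'I_n}) : nat :=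
  (\sum_(x in H) weight x + \max_(x in H) excess x)%N.

Lemma swap_weight i (x : 'I_n) : (i < M)%N ->
  (weight x <= weight (slow_perm i x) + ((x : nat) == (r + i)%N))%N
  /\ (excess x <= excess (slow_perm i x))%N.
Proof.
move=> iM; have := ltn_ord x => xn; rewrite slow_permE /slow_move iM /weight /excess.
by split; repeat case: ifP; lia.
Qed.

Lemma cycle_weight i (x : 'I_n) : (M <= i)%N ->
  (weight x <= weight (slow_perm i x))%N
  /\ (excess x <= (excess (slow_perm i x)).+1)%N.
Proof.
move=> iM; have := ltn_ord x => xn.
rewrite slow_permE /slow_move ltnNge iM /weight /excess /=.
by split; repeat case: ifP; lia.
Qed.

(** Under a swap only a hole at [r + i] loses weight, by one, and no excess drops. Under a cycle no
    weight drops and each excess, hence the maximum, drops by at most one. *)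
Lemma potential_move i H : (potential H <= (potential (slow_perm i @: H)).+1)%N.
Proof.
rewrite /potential !(big_imset _ (in2W (@perm_inj _ (slow_perm i)))) /=.
have [iM|Mi] := ltnP i M.
  rewrite -addSn; apply: leq_add; last first.
    apply/bigmax_leqP => x xH; apply: leq_trans (swap_weight x iM).2 _.
    exact: (@leq_bigmax_cond _ _ (fun x => excess (slow_perm i x))).
  have /leq_trans -> // : (\sum_(x in H) weight x <=
      \sum_(x in H) (weight (slow_perm i x) + ((x : nat) == (r + i)%N)))%N.
    by apply: leq_sum => x _; have [] := swap_weight x iM.
  rewrite big_split /= -addn1 leq_add2l -big_mkcondr sum1_card.
  apply/card_le1_eqP => x y; rewrite !unfold_in => /andP[_ /eqP ex] /andP[_ /eqP ey].
  by apply: val_inj; rewrite /= ex ey.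
rewrite -addnS; apply: leq_add.
  by apply: leq_sum => x _; have [] := cycle_weight x Mi.
apply/bigmax_leqP => x xH; apply: leq_trans (cycle_weight x Mi).2 _.
by rewrite ltnS; apply: (@leq_bigmax_cond _ _ (fun x => excess (slow_perm i x))).
Qed.

Lemma potential_fill H : (potential H <= potential (H :\: sources))%N.
Proof.
have S0 x : x \in sources -> (weight x = 0 /\ excess x = 0)%N.
  by rewrite inE /weight /excess; lia.
apply: leq_add.
  rewrite (big_setID sources) /= big1 // => x /setIP[_ /S0[]] //.
apply/bigmax_leqP => x xH; have [/S0[_ ->] //|xS] := boolP (x \in sources).
by apply: leq_bigmax_cond; rewrite inE xS.
Qed.

Lemma potential_holes s : (potential setT <= potential (holes s) + size s)%N.
Proof.
elim/last_ind: s => [|s i IHs]; first by rewrite addn0.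
rewrite size_rcons addnS -addSn; apply: leq_trans IHs _; rewrite leq_add2r holes_rcons.
exact: leq_trans (potential_fill _) (potential_move _ _).
Qed.

Lemma sum_weight k : (k <= M)%N -> (\sum_(0 <= x < r + k) weight x = 'C(k.+1, 2))%N.
Proof.
elim: k => [|k IHk] kM.
  by rewrite addn0 big_nat big1 // => x /=; rewrite /weight; lia.
rewrite addnS big_nat_recr //= IHk ?(ltnW kM) // [RHS]binS bin1.
by congr addn; rewrite /weight; lia.
Qed.

Lemma potential_setT : ('C(M.+1, 2) + (n - r) <= potential setT)%N.
Proof.
have ex : (excess n.-1 <= \max_(x in [set: 'I_n]) excess x)%N.
  have n0 : (n.-1 < n)%N by lia.
  exact: (@leq_bigmax_cond _ _ (fun x : 'I_n => excess x) (Ordinal n0)).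
have sm : ('C(M.+1, 2) + M <= \sum_(x in [set: 'I_n]) weight x)%N.
  under eq_bigl do rewrite inE.
  rewrite -(big_mkord xpredT weight) (big_cat_nat _ Mn) //=.
  rewrite big_nat_recr //= sum_weight // -addnA leq_add2l.
  (* Coordinates beyond [r + M] are discarded from the sum; the [M] kept here and the excess
     [n - r - M] of the last coordinate make up [n - r]. *)
  by apply: leq_trans (leq_addr _ _); rewrite /weight; lia.
rewrite /potential; move: ex sm; rewrite {1}/excess; lia.
Qed.

(** The inequality is strict because before the last letter the holes must already lie in the
    sources, where the potential is zero. *)
Lemma slow_length s : controllable_seq slow_system s ->
  ('C(M.+1, 2) + (n - r) < size s)%N.
Proof.
move=> /holes_controllable; case/lastP: s => [|s i].
  by move/setP/(_ (Ordinal Mn)); rewrite !inE.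
rewrite holes_rcons size_rcons ltnS => /eqP; rewrite imset_eq0 => /eqP H0.
apply: leq_trans potential_setT (leq_trans (potential_holes s) _).
have := potential_fill (holes s).
by rewrite H0 /potential !big_set0 leqn0 addn_eq0 => /andP[/eqP-> /eqP->].
Qed.

Lemma slow_classB : classB r slow_system.
Proof.
have [||| s [_ cs]] := only_full_controllable slow_A_unit (r := r) slow_only_full.
- by move=> i; rewrite slow_B_rank.
- lia.
- lia.
split; first by move=> x; exists s; apply: cs.
by split; [apply: slow_A_unit | apply: slow_B_rank].
Qed.

End SlowSystem.

(** * Existence of the maxima and conclusion *)

Lemma bounded_max_exists (P : nat -> Prop) (k B : nat) :
  P k -> (forall j, P j -> (j <= B)%N) -> exists2 c, P c & forall j, P j -> (j <= c)%N.
Proof.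
move=> Pk; elim: B => [|B IHB] bnd; first by exists k => // j /bnd; lia.
(* [P] will quantify over real systems, hence excluded middle. *)
have [PB|nPB] := classic (P B.+1); first by exists B.+1.
apply: IHB => j Pj; have := bnd j Pj; rewrite leq_eqVlt => /orP[/eqP e|//].
by rewrite e in Pj.
Qed.

Lemma classB_sub n r m (S : switched_system n m) : classB r S -> classBbar r S.
Proof. by case=> ctrl [unitA rk]; split=> //; split=> // i; rewrite rk. Qed.

Lemma classBbar_min_length n r m (S : switched_system n m) :
  classBbar r S -> (0 < r <= n)%N -> (0 < m)%N ->
  exists2 k, min_ctrl_length S k & (k <= ((n - r + 1) * (n - r))./2 + 1)%N.
Proof.
move=> [ctrl [unitA rk]] rn m0.
have [s [ss /min_ctrl_length_exists [k mk ks]]] :=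
  only_full_controllable unitA (controllable_only_full unitA ctrl) rk rn m0.
by exists k => //; apply: leq_trans ss.
Qed.

Lemma min_ctrl_length_unique n m (S : switched_system n m) j k :
  min_ctrl_length S j -> min_ctrl_length S k -> j = k.
Proof.
move=> [[s [<- cs]] mj] [[t [<- ct]] mk].
by apply/eqP; rewrite eqn_leq mj ?mk.
Qed.

Lemma is_max_min_length_exists n r m (C : switched_system n m -> Prop) S0 :
  (forall S, C S -> classBbar r S) -> C S0 -> (0 < r <= n)%N -> (0 < m)%N ->
  exists2 c, is_max_min_length C c & (c <= ((n - r + 1) * (n - r))./2 + 1)%N.
Proof.
move=> subC C0 rn m0; pose P k := exists S, C S /\ min_ctrl_length S k.
have bnd k : P k -> (k <= ((n - r + 1) * (n - r))./2 + 1)%N.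
  move=> [S [/subC CS mk]]; have [j mj jle] := classBbar_min_length CS rn m0.
  by rewrite (min_ctrl_length_unique mk mj).
have [k0 mk0 _] := classBbar_min_length (subC _ C0) rn m0.
have [c Pc cmax] := bounded_max_exists (ex_intro _ S0 (conj C0 mk0)) bnd.
exists c; last exact: bnd.
by split=> // S k CS mk; apply: cmax; exists S.
Qed.

Local Close Scope ring_scope.

(* B(n,r,m) and Bbar(n,r,m) exist (as maxima) and satisfy the bounds. *)
Theorem theorem3 (n m r : nat) :
  (2 <= n)%N -> (1 <= m)%N -> (1 <= r)%N -> (r < n)%N ->
  exists b bb : nat,
    is_B n r m b /\ is_Bbar n r m bb /\
    (b <= bb)%N /\ (bb <= ((n - r + 1) * (n - r))./2 + 1)%N /\
    ((m <= n - r)%N -> (n - r + 1 + (m * (m - 1))./2 <= b)%N) /\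
    ((n - r <= m)%N -> b = ((n - r + 1) * (n - r))./2 + 1 /\
                       bb = ((n - r + 1) * (n - r))./2 + 1).
Proof.
move=> _ m0 r0 rn; have rn' : (0 < r <= n)%N by lia.
(* One mode is kept for the cycle, and at most [n - r - 1] swaps fit; surplus modes duplicate the
   cycle. For [m >= n - r] this makes the two bounds meet. *)
pose M := (minn m (n - r)).-1.
have Mm : (M < m)%N by rewrite /M; lia.
have Mn : (r + M < n)%N by rewrite /M; lia.
have slowB := slow_classB r0 Mm Mn.
have [c maxc _] := is_max_min_length_exists (@classB_sub n r m) slowB rn' m0.
have [cc maxcc ccle] := is_max_min_length_exists (fun _ => id) (classB_sub slowB) rn' m0.
exists c, cc.
have ccc : (c <= cc)%N.
  case: maxc => [[S [CS mS]] _]; exact: (maxcc.2 S) (classB_sub CS) mS.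
have low : ('C(M.+1, 2) + (n - r) < c)%N.
  have [k mk _] := classBbar_min_length (classB_sub slowB) rn' m0.
  apply: leq_trans _ (maxc.2 _ _ slowB mk).
  by case: mk => [[s [<- cs]] _]; exact: slow_length cs.
do 4 (split=> //); split=> [mn|nm].
  have -> : (n - r + 1 + (m * (m - 1))./2 = ('C(M.+1, 2) + (n - r)).+1)%N.
    have -> : M.+1 = m by rewrite /M; lia.
    by rewrite bin2 subn1; lia.
  by [].
have up : (('C(M.+1, 2) + (n - r)).+1 = ((n - r + 1) * (n - r))./2 + 1)%N.
  have -> : M.+1 = (n - r)%N by rewrite /M; lia.
  by rewrite addn1 (addn1 (n - r)) -[(_ * _)./2](bin2 (n - r).+1) binS bin1.
by split; apply/eqP; rewrite eqn_leq; lia.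
Qed.
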